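(* Let $L$ be a nilpotent, finite-dimensional diassociative algebra over a field $\mathbb{F}$ and let $Z\subseteq Z(L)\cap L'$ be an ideal of $L$ such that $\dim Z=1$. Then $$\dim\mathcal{H}^2(L,\mathbb{F})+1\le \dim\mathcal{H}^2(L/Z,\mathbb{F})+4\dim(L/L').$$
   Context: A diassociative algebra $L$ over a field $\mathbb{F}$ is an $\mathbb{F}$-vector space with two associative bilinear products $\dashv,\vdash$ satisfying $x\dashv(y\dashv z)=x\dashv(y\vdash z)$, $(x\vdash y)\dashv z=x\vdash(y\dashv z)$, $(x\dashv y)\vdash z=(x\vdash y)\vdash z$ for all $x,y,z\in L$. An ideal $I$ is a subspace closed under both products with $x\dashv i,\ x\vdash i,\ i\dashv x,\ i\vdash x\in I$ for all $i\in I$, $x\in L$. The center $Z(L)$ is the set of $z\in L$ with $z\dashv x=z\vdash x=x\dashv z=x\vdash z=0$ for all $x\in L$. For subalgebras $X,Y$ of $L$, $X\lozenge Y=X\dashv Y+X\vdash Y$, where $X\dashv Y$ and $X\vdash Y$ are the spans of the corresponding products. $L'=L\lozenge L$. The lower central series is $L^1=L$, $L^{k+1}=L^1\lozenge L^k+L^2\lozenge L^{k-1}+\cdots+L^k\lozenge L^1$; $L$ is nilpotent if $L^k=0$ for some $k$. For a diassociative algebra $Q$ over $\mathbb{F}$, $\mathcal{Z}^2(Q,\mathbb{F})$ is the space of pairs $(f_{\dashv},f_{\vdash})$ of bilinear forms $Q\times Q\to\mathbb{F}$ such that for all $i,j,k\in Q$: $f_{\dashv}(i,j\dashv k)=f_{\dashv}(i,j\vdash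 k)$; $f_{\dashv}(i\vdash j,k)=f_{\vdash}(i,j\dashv k)$; $f_{\vdash}(i\dashv j,k)=f_{\vdash}(i\vdash j,k)$; $f_{\dashv}(i,j\dashv k)=f_{\dashv}(i\dashv j,k)$; $f_{\vdash}(i,j\vdash k)=f_{\vdash}(i\vdash j,k)$. $\mathcal{B}^2(Q,\mathbb{F})$ is the subspace of pairs for which there is a linear map $\varepsilon:Q\to\mathbb{F}$ with $f_{\dashv}(x,y)=-\varepsilon(x\dashv y)$ and $f_{\vdash}(x,y)=-\varepsilon(x\vdash y)$ for all $x,y$; and $\mathcal{H}^2(Q,\mathbb{F})=\mathcal{Z}^2(Q,\mathbb{F})/\mathcal{B}^2(Q,\mathbb{F})$. *)

(* Defs.v *)
From HB Require Import structures.
From mathcomp Require Import all_boot all_algebra.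

Set Implicit Arguments.
Unset Strict Implicit.
Unset Printing Implicit Defensive.

Import GRing.Theory VectorInternalTheory.
Local Open Scope ring_scope.
Local Open Scope quotient_scope.

(* Quotient of a finite-dimensional space V by a subspace U: the type of      *)
(* cosets {quot U} of ring_quotient, made into a vectType.                    *)
Section QuotientSpace.
Variables (K : fieldType) (V : vectType K) (U : {vspace V}).

Definition vquot : Type := Quotient.quot U.

HB.instance Definition _ := GRing.Zmodule.on vquot.

Definition vcoset (x : V) : vquot := \pi_(Quotient.quot U) x.
Definition vrepr (q : vquot) : V := repr (q : Quotient.quot U).

Lemma vreprK : cancel vrepr vcoset.
Proof. by move=> q; apply: reprK. Qed.

Lemma vcosetP x y : reflect (vcoset x = vcoset y) (x - y \in U).
Proof. by rewrite Quotient.idealrBE; apply: eqP. Qed.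

Lemma vreprB x : vrepr (vcoset x) - x \in U.
Proof. by apply/vcosetP; rewrite vreprK. Qed.

Lemma vcosetD x y : vcoset (x + y) = vcoset x + vcoset y.
Proof. by rewrite /vcoset Quotient.pi_add. Qed.

Definition vquot_scale (a : K) (q : vquot) : vquot := vcoset (a *: vrepr q).

Lemma vcosetZ_subproof a x : vcoset (a *: x) = vquot_scale a (vcoset x).
Proof.
by apply/vcosetP; rewrite -scalerBr memvZ // -opprB memvN vreprB.
Qed.

Fact vquot_scaleA a b q :
  vquot_scale a (vquot_scale b q) = vquot_scale (a * b) q.
Proof. by rewrite -[q]vreprK -!vcosetZ_subproof scalerA. Qed.

Fact vquot_scale1 : left_id 1 vquot_scale.
Proof. by move=> q; rewrite -[q]vreprK -vcosetZ_subproof scale1r. Qed.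

Fact vquot_scaleDr : right_distributive vquot_scale +%R.
Proof.
move=> a p q; rewrite -[p]vreprK -[q]vreprK -vcosetD -!vcosetZ_subproof.
by rewrite scalerDr vcosetD.
Qed.

Fact vquot_scaleDl q : {morph vquot_scale^~ q : a b / a + b}.
Proof.
by move=> a b; rewrite -[q]vreprK -!vcosetZ_subproof scalerDl vcosetD.
Qed.

HB.instance Definition _ := GRing.Zmodule_isLmodule.Build K vquot
  vquot_scaleA vquot_scale1 vquot_scaleDr vquot_scaleDl.

Fact vcoset_is_linear : linear vcoset.
Proof. by move=> a x y; rewrite vcosetD vcosetZ_subproof. Qed.

HB.instance Definition _ :=
  GRing.isLinear.Build K V vquot _ vcoset vcoset_is_linear.

Fact vquot_vect_iso : Vector.axiom (\dim (U^C)) vquot.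
Proof.
have dUC : (U^C :&: U = 0)%VS by rewrite capvC capv_compl.
have sUC x : x \in (U^C + U)%VS by rewrite addvC addv_complf memvf.
pose g (x : V) := vsproj (U^C)%VS (daddv_pi (U^C) U x).
have g0 x : x \in U -> g x = 0.
  move=> Ux; rewrite /g; have := daddv_pi_add dUC (sUC x).
  rewrite (daddv_pi_id _ Ux) 1?capvC //.
  by move/(canRL (addrK _)); rewrite subrr => ->; rewrite linear0.
have gL : linear g by move=> a x y; rewrite /g !linearP.
have gB x y : g (x - y) = g x - g y.
  by rewrite /g !linearB.
have gC x y : x - y \in U -> g x = g y.
  by move=> /g0 /eqP; rewrite gB subr_eq0 => /eqP.
exists (v2r \o g \o vrepr).
  move=> a p q; transitivity (v2r (a *: g (vrepr p) + g (vrepr q))).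
    rewrite /= (gC _ (a *: vrepr p + vrepr q)) ?gL //.
    by apply/vcosetP; rewrite vreprK linearP /= !vreprK.
  by rewrite linearP.
apply: (Bijective (g := vcoset \o vsval \o r2v)) => [q|r] /=.
  rewrite v2rK -[RHS]vreprK; apply/vcosetP; rewrite vsprojK ?memv_pi //.
  rewrite -opprB memvN.
  rewrite -{1}(daddv_pi_add dUC (sUC (vrepr q))) addrAC subrr add0r.
  exact: memv_pi.
rewrite (gC _ _ (vreprB _)) /g daddv_pi_id ?vsvalK ?r2vK //.
exact: subvsP.
Qed.

HB.instance Definition _ := Lmodule_hasFinDim.Build K vquot vquot_vect_iso.

Lemma dim_vquot : \dim {: vquot} = (\dim {: V} - \dim U)%N.
Proof. by rewrite dimvf -dimv_compl. Qed.

End QuotientSpace.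

Arguments vcoset {K V} U x.
Arguments vrepr {K V U} q.

Declare Scope diass_scope.
Delimit Scope diass_scope with D.
Reserved Notation "x ⊣ y" (at level 40, left associativity).
Reserved Notation "x ⊢ y" (at level 40, left associativity).
Reserved Notation "X ◊ Y" (at level 40, left associativity).

HB.mixin Record Vector_isDiassociative (F : fieldType) L of Vector F L := {
  dashv : L -> L -> L;
  vdash : L -> L -> L;
  dashv_linearr : forall x, linear (dashv x);
  dashv_linearl : forall y, linear (dashv ^~ y);
  vdash_linearr : forall x, linear (vdash x);
  vdash_linearl : forall y, linear (vdash ^~ y);
  dashvA : associative dashv;
  vdashA : associative vdash;
  dashv_dashvr : forall x y z, dashv x (dashv y z) = dashv x (vdash y z);
  vdash_dashvA : forall x y z, dashv (vdash x y) z = vdash x (dashv y z);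
  vdash_vdashl : forall x y z, vdash (dashv x y) z = vdash (vdash x y) z
}.

#[short(type="diassType")]
HB.structure Definition Diassociative (F : fieldType) :=
  { L of Vector_isDiassociative F L & Vector F L }.

Notation "x ⊣ y" := (dashv x y) : diass_scope.
Notation "x ⊢ y" := (vdash x y) : diass_scope.
Local Open Scope diass_scope.

Section LinearProducts.
Variables (F : fieldType) (L : diassType F).

HB.instance Definition _ (x : L) :=
  GRing.isLinear.Build F L L _ (dashv x) (dashv_linearr x).
HB.instance Definition _ (x : L) :=
  GRing.isLinear.Build F L L _ (vdash x) (vdash_linearr x).

Definition dashvr (y x : L) : L := x ⊣ y.
Definition vdashr (y x : L) : L := x ⊢ y.

HB.instance Definition _ (y : L) :=
  GRing.isLinear.Build F L L _ (dashvr y) (dashv_linearl y).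
HB.instance Definition _ (y : L) :=
  GRing.isLinear.Build F L L _ (vdashr y) (vdash_linearl y).

Lemma dashvrE y x : dashvr y x = x ⊣ y. Proof. by []. Qed.
Lemma vdashrE y x : vdashr y x = x ⊢ y. Proof. by []. Qed.

End LinearProducts.

Section Subspaces.
Variables (F : fieldType) (L : diassType F).
Implicit Types (x y z : L) (X Y W : {vspace L}) (k : nat).

Definition ideal (I : {vspace L}) : Prop := forall x i, i \in I ->
  [/\ x ⊣ i \in I, x ⊢ i \in I, i ⊣ x \in I & i ⊢ x \in I].

(* The vectors killed by multiplication on either side by a basis of L; see   *)
(* centerP.                                                                   *)
Definition center : {vspace L} :=
  (\bigcap_(b <- vbasis {: L})
     (lker (linfun (dashv b)) :&: lker (linfun (vdash b))
      :&: lker (linfun (dashvr b)) :&: lker (linfun (vdashr b))))%VS.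

Lemma linear_basis0 (V W : vectType F) (f g : {linear V -> W}) :
  (forall b, b \in vbasis {: V} -> f b = g b) -> f =1 g.
Proof.
move=> fg x; rewrite (coord_vbasis (memvf x)) !linear_sum /=.
by apply: eq_bigr => i _; rewrite !linearZ /= fg // mem_nth ?size_tuple.
Qed.

Lemma memv_bigcap_seq (V : vectType F) (T : eqType) (s : seq T)
    (A : T -> {vspace V}) v :
  (v \in \bigcap_(b <- s) A b)%VS = all (fun b => v \in A b) s.
Proof.
by elim: s => [|b s IH]; rewrite ?big_nil ?memvf // big_cons memv_cap IH.
Qed.

Lemma centerP z :
  reflect (forall x, [/\ z ⊣ x = 0, z ⊢ x = 0, x ⊣ z = 0 & x ⊢ z = 0])
          (z \in center).
Proof.
rewrite memv_bigcap_seq; apply: (iffP allP) => [zC x | zC b _].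
  have zb b : b \in vbasis {: L} ->
      [/\ z ⊣ b = 0, z ⊢ b = 0, b ⊣ z = 0 & b ⊢ z = 0].
    move=> /zC; rewrite !memv_cap !memv_ker !lfunE /=.
    by case/andP=> /andP[/andP[/eqP-> /eqP->] /eqP zb /eqP zb'].
  split.
  - by apply: (@linear_basis0 _ _ (dashv z) \0%R) => b /zb[].
  - by apply: (@linear_basis0 _ _ (vdash z) \0%R) => b /zb[].
  - by apply: (@linear_basis0 _ _ (dashvr z) \0%R) => b /zb[].
  - by apply: (@linear_basis0 _ _ (vdashr z) \0%R) => b /zb[].
have [zb1 zb2 zb3 zb4] := zC b.
by rewrite !memv_cap !memv_ker !lfunE /= !dashvrE !vdashrE zb1 zb2 zb3 zb4 eqxx.
Qed.

(* As for prodv in falgebra, the span of all products is computed from bases; *)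
(* see dashvv_subP, vdashvv_subP.                                             *)
Definition dashvv X Y : {vspace L} :=
  <<[seq x ⊣ y | x <- vbasis X, y <- vbasis Y]>>%VS.
Definition vdashvv X Y : {vspace L} :=
  <<[seq x ⊢ y | x <- vbasis X, y <- vbasis Y]>>%VS.
Definition lozenge X Y : {vspace L} := (dashvv X Y + vdashvv X Y)%VS.

Lemma linear_basis_sub (U V : vectType F) (f : U -> V)
    (A : {vspace U}) (B : {vspace V}) : linear f ->
  (forall b, b \in vbasis A -> f b \in B) -> forall x : U, x \in A -> f x \in B.
Proof.
move=> fL fB x Ax; pose fM := GRing.isLinear.Build F U V _ f fL.
pose g : {linear U -> V} := HB.pack f fM.
rewrite (coord_vbasis Ax) -[f _]/(g _) linear_sum memv_suml // => i _.
by rewrite linearZ memvZ //= fB // mem_nth ?size_tuple.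
Qed.

Lemma bilinear_span_subP (m : L -> L -> L) X Y W :
    (forall x, linear (m x)) -> (forall y, linear (m ^~ y)) ->
  reflect (forall x y, x \in X -> y \in Y -> m x y \in W)
          (<<[seq m x y | x <- vbasis X, y <- vbasis Y]>> <= W)%VS.
Proof.
move=> mr ml; apply: (iffP span_subvP) => [sW x y Xx Yy | sW v].
  apply: (linear_basis_sub (ml y)) Xx => b Xb.
  apply: (linear_basis_sub (mr b)) Yy => c Yc.
  exact: sW (allpairs_f _ Xb Yc).
by case/allpairsP=> -[x y] /= [/vbasis_mem Xx /vbasis_mem Yy ->]; apply: sW.
Qed.

Lemma dashvv_subP X Y W :
  reflect (forall x y, x \in X -> y \in Y -> x ⊣ y \in W)
          (dashvv X Y <= W)%VS.
Proof.
by apply: bilinear_span_subP; [apply: dashv_linearr | apply: dashv_linearl].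
Qed.

Lemma vdashvv_subP X Y W :
  reflect (forall x y, x \in X -> y \in Y -> x ⊢ y \in W)
          (vdashvv X Y <= W)%VS.
Proof.
by apply: bilinear_span_subP; [apply: vdash_linearr | apply: vdash_linearl].
Qed.

Local Notation "X ◊ Y" := (lozenge X Y).

Definition derived : {vspace L} := fullv ◊ fullv.

(* [:: L^1; ...; L^n] *)
Fixpoint lcs_seq (n : nat) : seq {vspace L} :=
  if n is n'.+1 then
    let s := lcs_seq n' in
    rcons s (if n' is 0 then fullv
             else \sum_(i < n') (nth fullv s i ◊ nth fullv s (n' - i.+1)%N))%VS
  else [::].

(* L^k, for k >= 1 (the value at k = 0 is irrelevant). *)
Definition lcs k : {vspace L} := nth fullv (lcs_seq k) k.-1.

Lemma size_lcs_seq n : size (lcs_seq n) = n.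
Proof. by elim: n => //= n IH; rewrite size_rcons IH. Qed.

Lemma nth_lcs_seq n i : (i < n)%N -> nth fullv (lcs_seq n) i = lcs i.+1.
Proof.
elim: n => // n IH; rewrite ltnS leq_eqVlt => /predU1P[-> // | lt_in].
by rewrite /= nth_rcons size_lcs_seq lt_in IH.
Qed.

Lemma lcs1 : lcs 1 = fullv. Proof. by []. Qed.

Lemma lcsS k : (0 < k)%N ->
  lcs k.+1 = (\sum_(1 <= i < k.+1) (lcs i ◊ lcs (k.+1 - i)%N))%VS.
Proof.
case: k => // k _; rewrite big_add1 big_mkord.
transitivity (\sum_(i < k.+1) (nth fullv (lcs_seq k.+1) i
                                ◊ nth fullv (lcs_seq k.+1) (k.+1 - i.+1)%N))%VS.
  by rewrite /lcs -[lcs_seq _]/(rcons (lcs_seq k.+1) _) nth_rcons size_lcs_seq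
             ltnn eqxx.
apply: eq_bigr => i _; rewrite !nth_lcs_seq ?subSS ?subSn //.
  by rewrite -ltnS.
by rewrite ltnS leq_subr.
Qed.

Definition nilpotent : Prop := exists2 k, (0 < k)%N & lcs k = 0%VS.

End Subspaces.

Arguments ideal {F L} I.
Arguments center {F} L.
Arguments derived {F} L.
Arguments lcs {F} L k.
Arguments nilpotent {F} L.
Notation "X ◊ Y" := (lozenge X Y) : diass_scope.

(* The quotient algebra L/I, with products (x + I) ⊣ (y + I) = x ⊣ y + I and  *)
(* (x + I) ⊢ (y + I) = x ⊢ y + I.                                             *)
Section QuotientAlgebra.
Variables (F : fieldType) (L : diassType F) (I : {vspace L}) (idI : ideal I).

Definition diquot of ideal I : Type := vquot I.
Local Notation Q := (diquot idI).

HB.instance Definition _ := Vector.on Q.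

Definition dicoset (x : L) : Q := vcoset I x.
Definition direpr (q : Q) : L := vrepr q.

Lemma direprK : cancel direpr dicoset. Proof. exact: vreprK. Qed.

Lemma dicosetP x y : reflect (dicoset x = dicoset y) (x - y \in I).
Proof. exact: vcosetP. Qed.

Lemma direprB x : direpr (dicoset x) - x \in I.
Proof. exact: vreprB. Qed.

Fact dicoset_is_linear : linear dicoset.
Proof. exact: vcoset_is_linear. Qed.

HB.instance Definition _ :=
  GRing.isLinear.Build F L Q _ dicoset dicoset_is_linear.

Definition quot_dashv (p q : Q) : Q := dicoset (direpr p ⊣ direpr q).
Definition quot_vdash (p q : Q) : Q := dicoset (direpr p ⊢ direpr q).

Lemma quot_dashvE x y : quot_dashv (dicoset x) (dicoset y) = dicoset (x ⊣ y).
Proof.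
have [_ _ I1 _] := idI (direpr (dicoset y)) (direprB x).
have [I2 _ _ _] := idI x (direprB y).
apply/dicosetP; rewrite -(subrKA (x ⊣ direpr (dicoset y))).
by rewrite -!dashvrE -linearB /= !dashvrE -linearB memvD.
Qed.

Lemma quot_vdashE x y : quot_vdash (dicoset x) (dicoset y) = dicoset (x ⊢ y).
Proof.
have [_ _ _ I1] := idI (direpr (dicoset y)) (direprB x).
have [_ I2 _ _] := idI x (direprB y).
apply/dicosetP; rewrite -(subrKA (x ⊢ direpr (dicoset y))).
by rewrite -!vdashrE -linearB /= !vdashrE -linearB memvD.
Qed.

Fact quot_dashv_linearr p : linear (quot_dashv p).
Proof.
move=> a q r; rewrite -[p]direprK -[q]direprK -[r]direprK.
by rewrite -linearP !quot_dashvE linearP /= linearP.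
Qed.

Fact quot_dashv_linearl q : linear (quot_dashv ^~ q).
Proof.
move=> a p r; rewrite -[p]direprK -[q]direprK -[r]direprK.
by rewrite -linearP !quot_dashvE -!dashvrE linearP /= linearP.
Qed.

Fact quot_vdash_linearr p : linear (quot_vdash p).
Proof.
move=> a q r; rewrite -[p]direprK -[q]direprK -[r]direprK.
by rewrite -linearP !quot_vdashE linearP /= linearP.
Qed.

Fact quot_vdash_linearl q : linear (quot_vdash ^~ q).
Proof.
move=> a p r; rewrite -[p]direprK -[q]direprK -[r]direprK.
by rewrite -linearP !quot_vdashE -!vdashrE linearP /= linearP.
Qed.

Fact quot_dashvA : associative quot_dashv.
Proof.
move=> p q r; rewrite -[p]direprK -[q]direprK -[r]direprK.
by rewrite !quot_dashvE dashvA.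
Qed.

Fact quot_vdashA : associative quot_vdash.
Proof.
move=> p q r; rewrite -[p]direprK -[q]direprK -[r]direprK.
by rewrite !quot_vdashE vdashA.
Qed.

Fact quot_dashv_dashvr p q r :
  quot_dashv p (quot_dashv q r) = quot_dashv p (quot_vdash q r).
Proof.
rewrite -[p]direprK -[q]direprK -[r]direprK.
by rewrite quot_vdashE !quot_dashvE dashv_dashvr.
Qed.

Fact quot_vdash_dashvA p q r :
  quot_dashv (quot_vdash p q) r = quot_vdash p (quot_dashv q r).
Proof.
rewrite -[p]direprK -[q]direprK -[r]direprK.
by rewrite quot_vdashE !quot_dashvE quot_vdashE vdash_dashvA.
Qed.

Fact quot_vdash_vdashl p q r :
  quot_vdash (quot_dashv p q) r = quot_vdash (quot_vdash p q) r.
Proof.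
rewrite -[p]direprK -[q]direprK -[r]direprK.
by rewrite quot_dashvE !quot_vdashE vdash_vdashl.
Qed.

HB.instance Definition _ := Vector_isDiassociative.Build F Q
  quot_dashv_linearr quot_dashv_linearl quot_vdash_linearr quot_vdash_linearl
  quot_dashvA quot_vdashA quot_dashv_dashvr quot_vdash_dashvA
  quot_vdash_vdashl.

Lemma dicoset_dashv x y : dicoset (x ⊣ y) = dicoset x ⊣ dicoset y.
Proof. by rewrite -quot_dashvE. Qed.

Lemma dicoset_vdash x y : dicoset (x ⊢ y) = dicoset x ⊢ dicoset y.
Proof. by rewrite -quot_vdashE. Qed.

End QuotientAlgebra.

Section Cohomology.
Variables (F : fieldType) (Q : diassType F).

(* Bilinear forms Q x Q -> F, in curried form. *)
Definition bilform : vectType F := 'Hom(Q, 'Hom(Q, F^o)).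

(* A pair f stands for (f_⊣, f_⊢) = (f.1, f.2). *)
Definition bilpair : vectType F := (bilform * bilform)%type.

Definition cocycle (f : bilpair) : Prop := forall i j k : Q,
  [/\ f.1 i (j ⊣ k) = f.1 i (j ⊢ k),
      f.1 (i ⊢ j) k = f.2 i (j ⊣ k),
      f.2 (i ⊣ j) k = f.2 (i ⊢ j) k,
      f.1 i (j ⊣ k) = f.1 (i ⊣ j) k &
      f.2 i (j ⊢ k) = f.2 (i ⊢ j) k].

(* The differences of the two sides of the five cocycle identities. *)
Definition cocycle_defect (i j k : Q) (f : bilpair) : 'rV[F]_5 :=
  \row_(m < 5) nth 0
    [:: f.1 i (j ⊣ k) - f.1 i (j ⊢ k);
        f.1 (i ⊢ j) k - f.2 i (j ⊣ k);
        f.2 (i ⊣ j) k - f.2 (i ⊢ j) k;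
        f.1 i (j ⊣ k) - f.1 (i ⊣ j) k;
        f.2 i (j ⊢ k) - f.2 (i ⊢ j) k] m.

Fact cocycle_defect_is_linear i j k : linear (cocycle_defect i j k).
Proof.
move=> a f g; apply/rowP => m; rewrite !mxE.
case: m => [[|[|[|[|[|//]]]]] ltm] /=; rewrite !add_lfunE !scale_lfunE;
  by rewrite mulrBr opprD addrACA.
Qed.

HB.instance Definition _ i j k :=
  GRing.isLinear.Build F bilpair 'rV[F]_5 _ _ (cocycle_defect_is_linear i j k).

Lemma cocycle_defect_eq0 i j k (f : bilpair) :
  reflect [/\ f.1 i (j ⊣ k) = f.1 i (j ⊢ k),
              f.1 (i ⊢ j) k = f.2 i (j ⊣ k),
              f.2 (i ⊣ j) k = f.2 (i ⊢ j) k,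
              f.1 i (j ⊣ k) = f.1 (i ⊣ j) k &
              f.2 i (j ⊢ k) = f.2 (i ⊢ j) k]
          (cocycle_defect i j k f == 0).
Proof.
apply: (iffP eqP) => [/rowP d0 | [e1 e2 e3 e4 e5]].
  by split; apply/subr0_eq;
    [have := d0 0 | have := d0 1 | have := d0 (inord 2) | have := d0 (inord 3)
    |have := d0 (inord 4)]; rewrite !mxE ?inordK.
apply/rowP => m; rewrite !mxE.
case: m => [[|[|[|[|[|//]]]]] ltm] /=; apply/eqP; rewrite subr_eq0; apply/eqP.
all: assumption.
Qed.

(* The subspace of all cocycles, cut out by the cocycle identities on a basis *)
(* of Q; see Z2P.                                                             *)
Definition Z2 : {vspace bilpair} :=
  (\bigcap_(i <- vbasis {: Q}) \bigcap_(j <- vbasis {: Q})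
     \bigcap_(k <- vbasis {: Q}) lker (linfun (cocycle_defect i j k)))%VS.

Fact cocycle_defect_linear1 j k f : linear (fun i => cocycle_defect i j k f).
Proof.
move=> a x y; apply/rowP => m; rewrite !mxE.
case: m => [[|[|[|[|[|//]]]]] ltm] /=;
  rewrite -?dashvrE -?vdashrE !linearP ?add_lfunE ?scale_lfunE;
  by rewrite mulrBr opprD addrACA.
Qed.

Fact cocycle_defect_linear2 i k f : linear (fun j => cocycle_defect i j k f).
Proof.
move=> a x y; apply/rowP => m; rewrite !mxE.
case: m => [[|[|[|[|[|//]]]]] ltm] /=;
  rewrite -?(dashvrE k) -?(vdashrE k) !linearP ?add_lfunE ?scale_lfunE;
  by rewrite /= ?opprD ?mulrBr ?scalerN addrACA.
Qed.

Fact cocycle_defect_linear3 i j f : linear (fun k => cocycle_defect i j k f).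
Proof.
move=> a x y; apply/rowP => m; rewrite !mxE.
case: m => [[|[|[|[|[|//]]]]] ltm] /=; rewrite !linearP;
  by rewrite /= ?opprD ?mulrBr ?scalerN addrACA.
Qed.

Lemma Z2P (f : bilpair) : reflect (cocycle f) (f \in Z2).
Proof.
rewrite memv_bigcap_seq; apply: (iffP allP) => [fZ i j k | fZ i _].
  apply/cocycle_defect_eq0; rewrite -memv0.
  apply: (linear_basis_sub (cocycle_defect_linear1 j k f) _ (memvf i)) => b Qb.
  apply: (linear_basis_sub (cocycle_defect_linear2 b k f) _ (memvf j)) => c Qc.
  apply: (linear_basis_sub (cocycle_defect_linear3 b c f) _ (memvf k)) => d Qd.
  have := fZ b Qb; rewrite memv_bigcap_seq => /allP/(_ c Qc).
  by rewrite memv_bigcap_seq => /allP/(_ d Qd); rewrite memv_ker lfunE memv0.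
rewrite memv_bigcap_seq; apply/allP => j _.
rewrite memv_bigcap_seq; apply/allP => k _.
by rewrite memv_ker lfunE; apply/cocycle_defect_eq0.
Qed.

(* The linear forms y |-> - eps (x ⊣ y) and y |-> - eps (x ⊢ y). *)
Definition cobd_dashv (eps : 'Hom(Q, F^o)) (x : Q) : 'Hom(Q, F^o) :=
  - (eps \o linfun (dashv x))%VF.
Definition cobd_vdash (eps : 'Hom(Q, F^o)) (x : Q) : 'Hom(Q, F^o) :=
  - (eps \o linfun (vdash x))%VF.

Lemma cobd_dashvE eps x y : cobd_dashv eps x y = - eps (x ⊣ y).
Proof. by rewrite opp_lfunE comp_lfunE lfunE. Qed.

Lemma cobd_vdashE eps x y : cobd_vdash eps x y = - eps (x ⊢ y).
Proof. by rewrite opp_lfunE comp_lfunE lfunE. Qed.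

Fact cobd_dashv_is_linear eps : linear (cobd_dashv eps).
Proof.
move=> a x y; apply/lfunP => z; rewrite add_lfunE scale_lfunE !cobd_dashvE.
by rewrite -!dashvrE !linearP /= ?opprD ?scalerN.
Qed.

Fact cobd_vdash_is_linear eps : linear (cobd_vdash eps).
Proof.
move=> a x y; apply/lfunP => z; rewrite add_lfunE scale_lfunE !cobd_vdashE.
by rewrite -!vdashrE !linearP /= ?opprD ?scalerN.
Qed.

HB.instance Definition _ eps := GRing.isLinear.Build F Q 'Hom(Q, F^o) _ _
  (cobd_dashv_is_linear eps).
HB.instance Definition _ eps := GRing.isLinear.Build F Q 'Hom(Q, F^o) _ _
  (cobd_vdash_is_linear eps).

Definition coboundary (eps : 'Hom(Q, F^o)) : bilpair :=
  (linfun (cobd_dashv eps), linfun (cobd_vdash eps)).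

Lemma coboundaryE eps x y :
  (coboundary eps).1 x y = - eps (x ⊣ y)
  /\ (coboundary eps).2 x y = - eps (x ⊢ y).
Proof.
by split; rewrite /= lfunE /= ?cobd_dashvE ?cobd_vdashE.
Qed.

Fact coboundary_is_linear : linear coboundary.
Proof.
move=> a d e; congr pair; apply/lfunP => x; apply/lfunP => y;
  have [cd1 cd2] := coboundaryE d x y; have [ce1 ce2] := coboundaryE e x y;
  have [c1 c2] := coboundaryE (a *: d + e) x y; move: c1 c2 cd1 cd2 ce1 ce2;
  rewrite /= !(add_lfunE, scale_lfunE) => c1 c2 cd1 cd2 ce1 ce2;
  by rewrite ?(c1, cd1, ce1) ?(c2, cd2, ce2) opprD scalerN.
Qed.

HB.instance Definition _ := GRing.isLinear.Build F 'Hom(Q, F^o) bilpair _ _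
  coboundary_is_linear.

Definition B2 : {vspace bilpair} := limg (linfun coboundary).

Lemma B2P (f : bilpair) :
  f \in B2 <-> exists eps : 'Hom(Q, F^o), forall x y,
    f.1 x y = - eps (x ⊣ y) /\ f.2 x y = - eps (x ⊢ y).
Proof.
split=> [/memv_imgP[eps _ ->] | [eps fE]].
  by exists eps => x y; rewrite lfunE; apply: coboundaryE.
suff -> : f = linfun coboundary eps by rewrite memv_img ?memvf.
rewrite lfunE; case: f fE => f g fE; congr pair; apply/lfunP => x;
  apply/lfunP => y; have /= [e1 e2] := fE x y; rewrite lfunE /=.
  by rewrite cobd_dashvE.
by rewrite cobd_vdashE.
Qed.

Lemma B2_sub_Z2 : (B2 <= Z2)%VS.
Proof.
apply/subvP => f /B2P[eps fE]; apply/Z2P => i j k.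
have f1E x y : f.1 x y = - eps (x ⊣ y) by case: (fE x y).
have f2E x y : f.2 x y = - eps (x ⊢ y) by case: (fE x y).
by rewrite !(f1E, f2E) dashv_dashvr vdash_dashvA vdash_vdashl -dashvA
           dashv_dashvr vdashA.
Qed.

(* Z2 / B2, with B2 seen as a subspace of the space Z2. *)
Definition H2 : vectType F :=
  vquot (linfun (vsval : subvs_of Z2 -> bilpair) @^-1: B2)%VS.

Lemma dim_H2 : \dim {: H2} = (\dim Z2 - \dim B2)%N.
Proof.
rewrite dim_vquot; congr subn; first by rewrite dimvf.
have inj : lker (linfun (vsval : subvs_of Z2 -> bilpair)) == 0%VS.
  by apply/lker0P => u v; rewrite !lfunE => /val_inj.
rewrite -(limg_dim_eq (f := linfun (vsval : subvs_of Z2 -> bilpair))).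
  rewrite lpreimK //; apply/subvP => f /(subvP B2_sub_Z2) Zf.
  by apply/memv_imgP; exists (vsproj Z2 f); rewrite ?memvf // lfunE /= vsprojK.
by rewrite (eqP inj) capv0.
Qed.

End Cohomology.

Arguments H2 {F} Q.

(* Main.v *)
Require Import Defs.
From HB Require Import structures.
From mathcomp Require Import all_boot all_algebra.
From mathcomp Require Import zify.

Set Implicit Arguments.
Unset Strict Implicit.
Unset Printing Implicit Defensive.

Import GRing.Theory.
Local Open Scope ring_scope.
Local Open Scope diass_scope.

(** Write Q = L/Z, let z span Z and let d = dim L/L'.  The argument is the part
of the Hochschild-Serre type sequence
  Hom(L, F) -> Hom(Z, F) -> H^2(Q, F) -> H^2(L, F) -> (L/L' (x) Z)^4
that concerns dimensions, carried out on cocycles and coboundaries separately.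

- Cocycles.  For a cocycle f and central z, the cocycle identities force the four
  linear forms f_⊣(x, z), f_⊣(z, x), f_⊢(x, z), f_⊢(z, x) of x to vanish on L'
  ([central_values_derived]).  They are thus determined by their 4d values on a
  basis of a complement of L'.  If they all vanish, then f is the inflation of a
  cocycle of Q ([inflation_section]).  By rank-nullity,
  dim Z^2(L) <= dim Z^2(Q) + 4d ([dim_Z2_quotient]).

- Coboundaries.  Inflation is injective and sends B^2(Q) into B^2(L).  The
  coboundary of a form eps with eps(z) <> 0 is not in the image: if it were the
  inflation of the coboundary of eta, then eps and the form induced by eta would
  agree on L', which contains z, while the induced form kills z.  Hence
  dim B^2(Q) < dim B^2(L) ([dim_B2_quotient]).

Since dim H^2 = dim Z^2 - dim B^2, subtracting the two inequalities gives the
bound. *)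

Section LinearForms.
Variables (F : fieldType) (L : diassType F).

Lemma exists_form_neq0 (V : vectType F) (v : V) : v != 0 ->
  exists eps : 'Hom(V, F^o), eps v != 0.
Proof.
move=> v0; have [/existsP[i ci]|] :=
  boolP [exists i, coord (vbasis {: V}) i v != 0].
  by exists (linfun (coord (vbasis {: V}) i : V -> F^o)); rewrite lfunE.
rewrite negb_exists => /forallP c0; case/eqP: v0.
rewrite (coord_vbasis (memvf v)) big1 // => i _.
by have := c0 i; rewrite negbK => /eqP->; rewrite scale0r.
Qed.

Lemma form_derived0 (eps : 'Hom(L, F^o)) :
    (forall x y, eps (x ⊣ y) = 0 /\ eps (x ⊢ y) = 0) ->
  (derived L <= lker eps)%VS.
Proof.
move=> e0; rewrite /derived /lozenge subv_add.
by apply/andP; split; [apply/dashvv_subP | apply/vdashvv_subP] => x y _ _;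
  rewrite memv_ker; have [e1 e2] := e0 x y; rewrite ?e1 ?e2.
Qed.

End LinearForms.

Section Pullback.
Variables (F : fieldType) (A B : diassType F) (h : 'Hom(A, B)).

Fact pull_form_subproof (f : bilform B) :
  linear (fun x : A => (f (h x) \o h)%VF).
Proof.
move=> a x y; apply/lfunP => v.
by rewrite !linearP !(add_lfunE, scale_lfunE, comp_lfunE).
Qed.

(** The bilinear form (x, y) |-> f (h x) (h y) on A. *)
Definition pull_form (f : bilform B) : bilform A :=
  let fM := GRing.isLinear.Build F A 'Hom(A, F^o) _ _ (pull_form_subproof f) in
  let g : {linear A -> 'Hom(A, F^o)} := HB.pack (fun x => (f (h x) \o h)%VF) fM
  in linfun g.

Lemma pull_formE f x y : pull_form f x y = f (h x) (h y).
Proof. by rewrite lfunE comp_lfunE. Qed.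

(** The map induced on pairs of bilinear forms by a linear map h : A -> B, which
need not be multiplicative: it is used both for the projection L -> L/Z and for
a linear section of it. *)
Definition pull (f : bilpair B) : bilpair A := (pull_form f.1, pull_form f.2).

Fact pull_is_linear : linear pull.
Proof.
move=> a f g; congr pair; apply/lfunP => x; apply/lfunP => y;
by rewrite /= !(add_lfunE, scale_lfunE, pull_formE).
Qed.

HB.instance Definition _ := GRing.isLinear.Build F (bilpair B) (bilpair A) _
  pull pull_is_linear.

End Pullback.

Section CentralValues.
Variables (F : fieldType) (L : diassType F).
Implicit Types (f : bilpair L) (x z : L).

(** The four values of f at x and z, gathered in a column so as to be linear in x.
They are meant for z in the center of L. *)
Definition central_values z f x : 'cV[F]_4 :=
  \col_(m < 4) nth 0 [:: f.1 x z; f.1 z x; f.2 x z; f.2 z x] m.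

Lemma central_values_eq0 z f x :
  reflect [/\ f.1 x z = 0, f.1 z x = 0, f.2 x z = 0 & f.2 z x = 0]
          (central_values z f x == 0).
Proof.
apply: (iffP eqP) => [/colP v0 | [e1 e2 e3 e4]].
  by split; [have := v0 0 | have := v0 1 | have := v0 (inord 2)
            | have := v0 (inord 3)]; rewrite !mxE ?inordK.
by apply/colP => m; rewrite !mxE; case: m => [[|[|[|[|//]]]] ltm] /=.
Qed.

Fact central_values_linearr z f : linear (central_values z f).
Proof.
move=> a x y; apply/colP => m; rewrite !mxE.
by case: m => [[|[|[|[|//]]]] ltm] /=;
  rewrite !linearP ?add_lfunE ?scale_lfunE.
Qed.

HB.instance Definition _ z f := GRing.isLinear.Build F L 'cV[F]_4 _
  (central_values z f) (central_values_linearr z f).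

(** For a product x = a ⊣ b or a ⊢ b, the cocycle identities regroup the triple
(a, b, z) or (z, a, b) so that one argument of f is a product with z, hence 0. *)
Lemma central_values_derived z f x :
  cocycle f -> z \in center L -> x \in derived L -> central_values z f x = 0.
Proof.
move=> fZ /centerP zC; set W := lker (linfun (central_values z f)).
suff /subvP sW : (derived L <= W)%VS.
  by move/sW; rewrite memv_ker lfunE => /eqP.
rewrite /derived /lozenge subv_add.
apply/andP; split; [apply/dashvv_subP | apply/vdashvv_subP] => a b _ _;
  rewrite memv_ker lfunE; apply/central_values_eq0;
  have [e1 e2 e3 e4 e5] := fZ a b z; have [e6 e7 e8 e9 e10] := fZ z a b;
  have [za1 za2 _ _] := zC a; have [_ _ zb3 zb4] := zC b.
- split; first by rewrite -e4 zb3 linear0.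
  + by rewrite e9 za1 linear0 lfunE.
  + by rewrite e3 -e5 zb4 linear0.
  by rewrite -e7 za2 linear0 lfunE.
split; first by rewrite e2 zb3 linear0.
+ by rewrite -e6 e9 za1 linear0 lfunE.
+ by rewrite -e5 zb4 linear0.
by rewrite e10 za2 linear0 lfunE.
Qed.

(** The central values of f at the vectors of a basis of a complement of L'.  For a
cocycle f this encodes the image of f in (L/L' (x) Z)^4. *)
Definition central_mx z f : 'M[F]_(4, \dim (derived L)^C) :=
  \matrix_(m, j) central_values z f (vbasis (derived L)^C)`_j m 0.

Fact central_mx_is_linear z : linear (central_mx z).
Proof.
move=> a f g; apply/matrixP => m j; rewrite !mxE.
by case: m => [[|[|[|[|//]]]] ltm] /=; rewrite !(add_lfunE, scale_lfunE).
Qed.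

HB.instance Definition _ z := GRing.isLinear.Build F (bilpair L) 'M[F]_(4, _) _
  (central_mx z) (central_mx_is_linear z).

Lemma central_mx_eq0 z f : cocycle f -> z \in center L -> central_mx z f = 0 ->
  forall x, central_values z f x = 0.
Proof.
move=> fZ zC f0 x.
have : x \in (derived L + (derived L)^C)%VS by rewrite addv_complf memvf.
case/memv_addP => y Dy [w Cw ->]; rewrite linearD /=.
rewrite (central_values_derived fZ zC Dy) add0r.
rewrite (coord_vbasis Cw) linear_sum big1 // => j _.
rewrite linearZ /=; apply/colP => m; move/matrixP/(_ m j): f0; rewrite !mxE.
by move->; rewrite mulr0.
Qed.

End CentralValues.

Section Inflation.
Variables (F : fieldType) (L : diassType F) (Z : {vspace L}) (idZ : ideal Z).
Local Notation Q := (diquot idZ).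

(** The projection L -> L/Z. *)
Definition coset_map : 'Hom(L, Q) := linfun (@dicoset F L Z idZ).

(** A linear section of the projection, unlike the choice of representatives
[direpr], which need not be linear. *)
Definition coset_section : 'Hom(Q, L) := (coset_map^-1)%VF.

Lemma coset_mapE x : coset_map x = dicoset idZ x.
Proof. by rewrite lfunE. Qed.

Lemma coset_sectionK q : dicoset idZ (coset_section q) = q.
Proof.
rewrite -coset_mapE limg_lfunVK //.
by rewrite -(direprK q) -coset_mapE memv_img ?memvf.
Qed.

(** Inflation of pairs of forms from L/Z to L. *)
Definition inflation : 'Hom(bilpair Q, bilpair L) := linfun (pull coset_map).

Lemma inflationE f x y :
  (inflation f).1 x y = f.1 (dicoset idZ x) (dicoset idZ y) /\
  (inflation f).2 x y = f.2 (dicoset idZ x) (dicoset idZ y).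
Proof. by rewrite lfunE /= !pull_formE !coset_mapE. Qed.

Lemma inflation_inj : lker inflation == 0%VS.
Proof.
apply/lker0P => f g fg.
rewrite [f]surjective_pairing [g]surjective_pairing.
congr pair; apply/lfunP => p; apply/lfunP => q;
  have [] := inflationE f (direpr p) (direpr q); rewrite fg;
  by have [-> ->] := inflationE g (direpr p) (direpr q); rewrite !direprK.
Qed.

(** A cocycle that vanishes as soon as one argument is in Z descends to L/Z, through
the linear section. *)
Lemma inflation_section (f : bilpair L) :
    (forall x z, z \in Z ->
       [/\ f.1 x z = 0, f.1 z x = 0, f.2 x z = 0 & f.2 z x = 0]) ->
  cocycle f -> f \in (inflation @: Z2 Q)%VS.
Proof.
move=> f0 fZ; pose s := coset_section.
(* The two forms only depend on the classes of their arguments. *)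
have f1C x x' y y' : dicoset idZ x = dicoset idZ x' ->
    dicoset idZ y = dicoset idZ y' -> f.1 x y = f.1 x' y'.
  move=> /dicosetP/(f0 y)[_ e1 _ _] /dicosetP/(f0 x')[e2 _ _ _].
  move: e1 e2; rewrite !linearB add_lfunE opp_lfunE.
  by move=> /subr0_eq-> /subr0_eq->.
have f2C x x' y y' : dicoset idZ x = dicoset idZ x' ->
    dicoset idZ y = dicoset idZ y' -> f.2 x y = f.2 x' y'.
  move=> /dicosetP/(f0 y)[_ _ _ e1] /dicosetP/(f0 x')[_ _ e2 _].
  move: e1 e2; rewrite !linearB add_lfunE opp_lfunE.
  by move=> /subr0_eq-> /subr0_eq->.
have sK q : dicoset idZ (s q) = q by apply: coset_sectionK.
(* The section is multiplicative modulo Z. *)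
have sv p q : dicoset idZ (s (p ⊣ q)) = dicoset idZ (s p ⊣ s q).
  by rewrite dicoset_dashv !sK.
have sw p q : dicoset idZ (s (p ⊢ q)) = dicoset idZ (s p ⊢ s q).
  by rewrite dicoset_vdash !sK.
apply/memv_imgP; exists (pull s f).
  apply/Z2P => i j k; have [e1 e2 e3 e4 e5] := fZ (s i) (s j) (s k).
  rewrite /= !pull_formE.
  rewrite (f1C _ _ _ _ erefl (sv j k)) (f1C _ _ _ _ erefl (sw j k)).
  rewrite (f1C _ _ _ _ (sv i j) erefl) (f1C _ _ _ _ (sw i j) erefl).
  rewrite (f2C _ _ _ _ erefl (sv j k)) (f2C _ _ _ _ erefl (sw j k)).
  by rewrite (f2C _ _ _ _ (sv i j) erefl) (f2C _ _ _ _ (sw i j) erefl).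
rewrite [f in LHS]surjective_pairing [RHS]surjective_pairing.
congr pair; apply/lfunP => x; apply/lfunP => y;
  have [e1 e2] := inflationE (pull s f) x y.
  by rewrite e1 pull_formE; apply: f1C; rewrite sK.
by rewrite e2 pull_formE; apply: f2C; rewrite sK.
Qed.

Lemma dim_Z2_quotient : (Z <= center L)%VS -> \dim Z = 1%N ->
  (\dim (Z2 L) <= \dim (Z2 Q) + 4 * \dim {: vquot (derived L)})%N.
Proof.
move=> sZC dimZ; set z := vpick Z.
have Zz : z \in Z by apply: memv_pick.
have z_span v : v \in Z -> exists a, v = a *: z.
  suff /eqP-> : Z == <[z]>%VS by case/vlineP => a ->; exists a.
  rewrite eq_sym eqEdim -memvE Zz dimZ dim_vline /z vpick0 -dimv_eq0 dimZ.
  by [].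
pose delta := linfun (central_mx z).
rewrite -(limg_ker_dim delta (Z2 L)) leq_add //.
  apply: (@leq_trans (\dim (inflation @: Z2 Q)%VS)).
    apply/dimvS/subvP => f; rewrite memv_cap memv_ker lfunE.
    case/andP=> /Z2P fZ /eqP f0; apply: (inflation_section _ fZ) => x v.
    have /central_values_eq0[e1 e2 e3 e4] :
      central_values z f x == 0.
      exact/eqP/(central_mx_eq0 fZ (subvP sZC _ Zz) f0).
    by case/z_span=> a ->; rewrite !linearZ !scale_lfunE /= e1 e2 e3 e4 !scaler0.
  by rewrite -(limg_ker_dim inflation (Z2 Q)) leq_addl.
apply: leq_trans (dimvS (subvf _)) _.
by rewrite dimvf dim_matrix dimv_compl dim_vquot.
Qed.

Lemma inflation_B2 : (inflation @: B2 Q <= B2 L)%VS.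
Proof.
apply/subvP => _ /memv_imgP[f /B2P[eps fE] ->]; apply/B2P.
exists (eps \o coset_map)%VF => x y; have [-> ->] := inflationE f x y.
have [-> ->] := fE (dicoset idZ x) (dicoset idZ y).
by rewrite !comp_lfunE !coset_mapE dicoset_dashv dicoset_vdash.
Qed.

Lemma dim_B2_quotient : (Z <= derived L)%VS -> Z != 0%VS ->
  (\dim (B2 Q) < \dim (B2 L))%N.
Proof.
move=> sZD; rewrite -vpick0; set z := vpick Z => /exists_form_neq0[eps epsz].
have Zz : z \in Z by apply: memv_pick.
rewrite -(@limg_dim_eq _ _ _ inflation); last first.
  by rewrite (eqP inflation_inj) capv0.
rewrite (ltn_leqif (dimv_leqif_sup inflation_B2)).
apply: contra epsz => /subvP/(_ (coboundary eps)) imc.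
have /memv_imgP[f /B2P[eta fE] ceps] : coboundary eps \in (inflation @: B2 Q)%VS.
  by apply: imc; rewrite -[coboundary eps]lfunE memv_img ?memvf.
have /subvP/(_ z) : (derived L <= lker (eps - (eta \o coset_map)%VF))%VS.
  apply: form_derived0 => x y; rewrite !add_lfunE !opp_lfunE !comp_lfunE.
  rewrite !coset_mapE dicoset_dashv dicoset_vdash.
  have [] := coboundaryE eps x y; have [] := fE (dicoset idZ x) (dicoset idZ y).
  have [] := inflationE f x y; rewrite -ceps => -> -> -> ->.
  by move=> /oppr_inj-> /oppr_inj->; rewrite !subrr.
rewrite (subvP sZD) // memv_ker add_lfunE opp_lfunE comp_lfunE coset_mapE.
suff -> : dicoset idZ z = 0 by rewrite linear0 subr0 => /(_ isT).
by rewrite -(linear0 (@dicoset F L Z idZ)); apply/dicosetP; rewrite subr0.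
Qed.

End Inflation.

Theorem corollary4p2 (F : fieldType) (L : diassType F) (Z : {vspace L})
    (idZ : ideal Z) (nilL : nilpotent L)
    (sZ : (Z <= center L :&: derived L)%VS) (dimZ : \dim Z = 1%N) :
  (\dim {: H2 L} + 1
     <= \dim {: H2 (diquot idZ)} + 4 * \dim {: vquot (derived L)})%N.
Proof.
move: sZ; rewrite subv_cap => /andP[sZC sZD].
have Z0 : Z != 0%VS by rewrite -dimv_eq0 dimZ.
have := dim_Z2_quotient idZ sZC dimZ; have := dim_B2_quotient idZ sZD Z0.
have := dimvS (B2_sub_Z2 L); have := dimvS (B2_sub_Z2 (diquot idZ)).
(* The inclusions B2 <= Z2 make the truncated subtractions of [dim_H2] exact. *)
rewrite !dim_H2; lia.
Qed.
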